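(* For every bipartition $(\lambda,\mu)\in Cr(n,m)$ one has $\pi(\lambda,\mu)=\sigma(\lambda,\mu)$.
   Context: $n,m$ are positive integers. $\lambda'$ denotes the conjugate of a partition $\lambda$. For $p,r\ge0$, $H(p,r)$ is the set of partitions $\lambda$ with $\lambda_{p+1}\le r$ (equivalently $\lambda'_{r+1}\le p$). $Cr(n,m)$ is the set of bipartitions (pairs of partitions) $(\lambda,\mu)$ for which there are nonnegative integers $p,q,r,s$ with $p+q=n$, $r+s=m$, $\lambda\in H(p,r)$, $\mu\in H(q,s)$. $X^+(n,m)$ is the set of $(a_1,\dots,a_n\mid b_1,\dots,b_m)\in\mathbb Z^n\oplus\mathbb Z^m$ with $a_1\ge\dots\ge a_n$, $b_1\ge\dots\ge b_m$. For $(\lambda,\mu)\in Cr(n,m)$ let $H(\lambda,\mu)=\{(i,j): 0\le i\le n,\ 0\le j\le m,\ \lambda\in H(i,m-j),\ \mu\in H(n-i,j)\}$, $p=\max\{i:(i,j)\in H(\lambda,\mu)\text{ for some }j\}$, $s=\max\{j:(p,j)\in H(\lambda,\mu)\}$; $(p,s)$ is the extremal pair, and $q=n-p$, $r=m-s$. The map $\pi:Cr(n,m)\to X^+(n,m)$ is $$\pi(\lambda,\mu)=(\lambda_1,\dots,\lambda_p,m-\mu_q,\dots,m-\mu_1\mid\lambda_1'-n,\dots,\lambda_r'-n,-\mu'_s,\dots,-\mu'_1).$$ For a partition $\lambda$, $Y_\lambda\subset\mathbb R^2$ is the infinite polygonal line $\bigcup_{i\ge0}[M_i,M_{i+1}]$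 through $M_0=(+\infty,0)$, $M_{2i-1}=(\lambda_i,i-1)$, $M_{2i}=(\lambda_i,i)$, $i\ge1$ (the first segment is a half-line). $\vartheta_{n,m}(x,y)=(m-x,n-y)$. Points are totally ordered by: $(x,y)>(\tilde x,\tilde y)$ iff $y>\tilde y$, or $y=\tilde y$ and $x<\tilde x$. For a non-increasing integer sequence $a=(a_1,\dots,a_n)$, $\Gamma_a$ is the polygonal line through $(+\infty,0),(a_1,0),(a_1,1),(a_2,1),\dots,(a_n,n-1),(a_n,n),(-\infty,n)$; for a non-increasing integer sequence $b=(b_1,\dots,b_m)$, $\hat\Gamma_b$ is the polygonal line through $(0,+\infty),(0,n+b_1),(1,n+b_1),(1,n+b_2),\dots,(m-1,n+b_m),(m,n+b_m),(m,-\infty)$. The map $\sigma:Cr(n,m)\to X^+(n,m)$: for $(\lambda,\mu)\in Cr(n,m)$ the lines $Y_\lambda$ and $\vartheta_{n,m}(Y_\mu)$ intersect; let $M$ be their maximal intersection point. For either line $Y$, let $Y^L$ (resp. $Y^R$) be the set of its points strictly less (resp. strictly greater) than $M$. Then $\sigma(\lambda,\mu)=(a\mid b)$ where $$\Gamma_a=Y_\lambda^L\cup\{M\}\cup\vartheta_{n,m}(Y_\mu)^R,\qquad\hat\Gamma_b=Y_\lambda^R\cup\{M\}\cup\vartheta_{n,m}(Y_\mu)^L.$$ *)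

(* Defs.v *)
From HB Require Import structures.
From mathcomp Require Import all_boot all_order all_algebra.
From mathcomp Require Import boolp classical_sets reals.
Set Implicit Arguments.
Unset Strict Implicit.
Unset Printing Implicit Defensive.
Import Order.TTheory GRing.Theory Num.Theory.

Definition is_intpart (s : seq nat) : bool := sorted geq s && (0 \notin s).

Definition intpart : Type := {s : seq nat | is_intpart s}.

(* [part lam i] is lam_i with the usual numbering from i = 1; it is 0 beyond
   the length.  The value at i = 0 is meaningless and never used. *)
Definition part (lam : intpart) (i : nat) : nat := nth 0 (val lam) i.-1.

Definition conj_seq (s : seq nat) : seq nat :=
  [seq count (leq j) s | j <- iota 1 (head 0 s)].

Lemma conj_seqP (s : seq nat) : is_intpart s -> is_intpart (conj_seq s).
Proof.
move=> _; apply/andP; split.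
  rewrite /conj_seq sorted_map.
  apply: (sub_sorted _ (iota_ltn_sorted 1 (head 0 s))) => i j /= ltij.
  by apply: sub_count => x /=; apply: leq_trans; apply: ltnW.
apply/negP => /mapP[j]; rewrite mem_iota => /andP[j1].
case: s => [|x s] /=; first by rewrite addn0 ltnNge j1.
by rewrite add1n ltnS => ->.
Qed.

Definition conjp (lam : intpart) : intpart :=
  exist _ (conj_seq (val lam)) (conj_seqP (valP lam)).

Definition in_hook (p r : nat) (lam : intpart) : bool := part lam p.+1 <= r.

Record Cr (n m : nat) : Type := MkCr {
  cr_lam : intpart;
  cr_mu : intpart;
  crP : exists p q r s : nat,
    [/\ p + q = n, r + s = m, in_hook p r cr_lam & in_hook q s cr_mu]
}.

Definition dominant (n m : nat) (ab : n.-tuple int * m.-tuple int) : bool :=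
  sorted (fun x y : int => (y <= x)%R) ab.1 &&
  sorted (fun x y : int => (y <= x)%R) ab.2.

Definition Xplus (n m : nat) : Type :=
  {ab : n.-tuple int * m.-tuple int | dominant ab}.

Section Pi.
Variables n m : nat.

Definition Hset (lam mu : intpart) : {set 'I_n.+1 * 'I_m.+1} :=
  [set ij : 'I_n.+1 * 'I_m.+1 |
    in_hook ij.1 (m - ij.2) lam && in_hook (n - ij.1) ij.2 mu].

Definition ext_p (lam mu : intpart) : nat :=
  \max_(ij in Hset lam mu) nat_of_ord ij.1.

Definition ext_s (lam mu : intpart) : nat :=
  \max_(ij in Hset lam mu | nat_of_ord ij.1 == ext_p lam mu)
    nat_of_ord ij.2.

Definition pi_a (lam mu : intpart) : seq int :=
  let p := ext_p lam mu in
  let q := n - p in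
  [seq (part lam i)%:Z%R | i <- iota 1 p] ++
  [seq (m%:Z - (part mu i)%:Z)%R | i <- rev (iota 1 q)].

Definition pi_b (lam mu : intpart) : seq int :=
  let s := ext_s lam mu in
  let r := m - s in
  [seq ((part (conjp lam) j)%:Z - n%:Z)%R | j <- iota 1 r] ++
  [seq (- (part (conjp mu) j)%:Z)%R | j <- rev (iota 1 s)].

Lemma part_le (lam : intpart) i j : i <= j -> part lam j <= part lam i.
Proof.
move=> leij; rewrite /part; case: lam => s /= /andP[ss _].
have le' : i.-1 <= j.-1 by rewrite -!subn1 leq_sub2r.
have [js|js] := ltnP j.-1 (size s); last by rewrite nth_default.
have geqT : transitive geq.
  by move=> x y z /= h1 h2; apply: leq_trans h2 h1.
by apply: (sorted_leq_nth geqT leqnn 0 ss) => //; apply: leq_ltn_trans js.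
Qed.

Lemma part_conj (lam : intpart) j :
  0 < j -> part (conjp lam) j = count (leq j) (val lam).
Proof.
move=> j0; rewrite /part /=; case: lam => s /= /andP[ss s0].
have [js|js] := ltnP j.-1 (head 0 s).
  rewrite (nth_map 0) ?size_iota // nth_iota // add1n prednK //.
rewrite nth_default; last by rewrite size_map size_iota.
apply/esym/eqP; rewrite -leqn0 leqNgt -has_count; apply/hasP => -[x xs jx].
case: s ss s0 js xs => [|y s] //= ss _ js.
have ys : x \in y :: s -> x <= y.
  rewrite inE => /predU1P[->//|xs].
  have geqT : transitive geq.
    by move=> a b c /= h1 h2; apply: leq_trans h2 h1.
  by have /allP/(_ _ xs) := order_path_min geqT ss.
by move=> /ys xy; have := leq_trans jx (leq_trans xy js); rewrite -ltnS prednK ?ltnn.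
Qed.

Lemma conj_hook (lam : intpart) i j :
  0 < j -> (part (conjp lam) j <= i) = (part lam i.+1 < j).
Proof.
move=> j0; rewrite part_conj // /part /=.
case: lam => s /= /andP[ss s0].
elim: s i ss {s0} => [|x s IH] i ss /=; first by rewrite nth_nil j0.
have geqT : transitive geq.
  by move=> a b c /= h1 h2; apply: leq_trans h2 h1.
have /allP xs := order_path_min geqT ss.
have [jx|xj] := leqP j x.
  by case: i => [|i] /=; [rewrite ltnNge jx | rewrite add1n ltnS IH // (path_sorted ss)].
have -> : count (leq j) s = 0.
  apply/eqP; rewrite -leqn0 leqNgt -has_count; apply/hasP => -[y /xs yx jy].
  by have := leq_trans jy yx; rewrite leqNgt xj.
rewrite add0n leq0n; case: i => [|i] /=; first by rewrite xj.
have [h|h] := ltnP i (size s); last by rewrite nth_default.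
by rewrite (leq_ltn_trans (xs _ (mem_nth 0 h))).
Qed.

Lemma extP (lm : Cr n m) (lam := cr_lam lm) (mu := cr_mu lm)
    (p := ext_p lam mu) (s := ext_s lam mu) :
  [/\ p <= n, s <= m,
      in_hook p (m - s) lam, in_hook (n - p) s mu &
      forall i j, i <= n -> j <= m ->
        in_hook i (m - j) lam -> in_hook (n - i) j mu ->
        i <= p /\ (i = p -> j <= s)].
Proof.
have inH (i j : nat) : i <= n -> j <= m ->
    in_hook i (m - j) lam -> in_hook (n - i) j mu ->
    (inord i, inord j) \in Hset lam mu.
  by move=> hi hj h1 h2; rewrite inE /= !inordK ?ltnS // h1.
have H0 : 0 < #|Hset lam mu|.
  have [p0 [q0 [r0 [s0 [e1 e2 h1 h2]]]]] := crP lm.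
  apply/card_gt0P; exists (inord p0, inord s0); apply: inH.
  - by rewrite -e1 leq_addr.
  - by rewrite -e2 leq_addl.
  - by rewrite -e2 addnK.
  - by rewrite -e1 addKn.
have [ij ijH pE] := @eq_bigmax_cond _ (mem (Hset lam mu))
  (fun ij => nat_of_ord ij.1) H0.
pose H' := [pred x : 'I_n.+1 * 'I_m.+1 | (x \in Hset lam mu) && (nat_of_ord x.1 == p)].
have H'0 : 0 < #|H'|.
  by apply/card_gt0P; exists ij; rewrite inE ijH /= /p /ext_p pE eqxx.
have [kl klH sE] := @eq_bigmax_cond _ H' (fun ij => nat_of_ord ij.2) H'0.
have sE' : s = kl.2 by rewrite -sE.
move: klH; rewrite inE => /andP[klH /eqP pE'].
move: (klH); rewrite inE pE' -sE' => /andP[h1 h2]; split => //.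
- by rewrite -pE' -ltnS.
- by rewrite sE' -ltnS.
move=> i j hi hj hl hm; have hij := inH i j hi hj hl hm.
have ii : (inord i : 'I_n.+1) = i :> nat by rewrite inordK.
have jj : (inord j : 'I_m.+1) = j :> nat by rewrite inordK.
split.
  by rewrite -ii; exact: (@leq_bigmax_cond _ (fun x => x \in Hset lam mu)
    (fun x => nat_of_ord x.1) (inord i, inord j) hij).
move=> ip; rewrite -jj.
apply: (@leq_bigmax_cond _ (fun x => (x \in Hset lam mu) && (nat_of_ord x.1 == p))
  (fun x => nat_of_ord x.2) (inord i, inord j)).
by rewrite hij /= ii ip eqxx.
Qed.

Lemma size_pi_a (lm : Cr n m) : size (pi_a (cr_lam lm) (cr_mu lm)) == n.
Proof.
have [pn _ _ _ _] := extP lm.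
by rewrite size_cat !size_map size_rev !size_iota subnKC.
Qed.

Lemma size_pi_b (lm : Cr n m) : size (pi_b (cr_lam lm) (cr_mu lm)) == m.
Proof.
have [_ sm _ _ _] := extP lm.
by rewrite size_cat !size_map size_rev !size_iota subnK.
Qed.

Lemma sorted_glue (f g : nat -> int) (k l : nat) :
  (forall i j, 0 < i -> i <= j -> (f j <= f i)%R) ->
  (forall i j, 0 < i -> i <= j -> (g i <= g j)%R) ->
  (0 < k -> 0 < l -> (g l <= f k)%R) ->
  sorted (fun x y : int => (y <= x)%R)
    ([seq f i | i <- iota 1 k] ++ [seq g i | i <- rev (iota 1 l)]).
Proof.
move=> hf hg hfg.
have tr : transitive (fun x y : int => (y <= x)%R).
  by move=> x y z h1 h2; apply: le_trans h2 h1.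
rewrite (sorted_pairwise tr) pairwise_cat; apply/and3P; split.
- apply/allrelP => x y /mapP[i + ->] /mapP[j + ->].
  rewrite mem_rev !mem_iota !add1n !ltnS => /andP[i0 ik] /andP[j0 jl].
  have k0 := leq_trans i0 ik; have l0 := leq_trans j0 jl.
  exact: le_trans (hg _ _ j0 jl) (le_trans (hfg k0 l0) (hf _ _ i0 ik)).
- rewrite pairwise_map.
  have : pairwise ltn (iota 1 k) by rewrite -(sorted_pairwise ltn_trans) iota_ltn_sorted.
  apply: (sub_in_pairwise (P := fun i => 0 < i)); last first.
    by apply/allP => i; rewrite mem_iota => /andP[].
  by move=> i j i0 _ /= /ltnW; apply: hf.
- rewrite map_rev -(sorted_pairwise tr) rev_sorted sorted_pairwise; last exact: le_trans.
  rewrite pairwise_map.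
  have : pairwise ltn (iota 1 l) by rewrite -(sorted_pairwise ltn_trans) iota_ltn_sorted.
  apply: (sub_in_pairwise (P := fun i => 0 < i)); last first.
    by apply/allP => i; rewrite mem_iota => /andP[].
  by move=> i j i0 _ /= /ltnW; apply: hg.
Qed.

Definition pi_tuples (lm : Cr n m) : n.-tuple int * m.-tuple int :=
  (Tuple (size_pi_a lm), Tuple (size_pi_b lm)).

Lemma pi_dominant (lm : Cr n m) : dominant (pi_tuples lm).
Proof.
have := extP lm; rewrite /dominant /= /pi_a /pi_b.
move: (cr_lam lm) (cr_mu lm) => lam mu.
set p := ext_p _ _; set s := ext_s _ _ => -[pn sm hl hm mx].
apply/andP; split.
  apply: sorted_glue.
  - by move=> i j _ ij; rewrite lez_nat part_le.
  - by move=> i j _ ij; rewrite lerB // lez_nat part_le.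
  move=> p0 q0; rewrite lerBlDr -PoszD lez_nat leqNgt; apply/negP => lt.
  have pn' : p < n by rewrite -subn_gt0.
  have lm' : part lam p <= m by exact: leq_trans (leq_addr _ _) (ltnW lt).
  have [] := mx p.+1 (m - part lam p) pn' (leq_subr _ _).
  - by rewrite /in_hook subKn // part_le // ltnW // ltnW.
  - rewrite /in_hook subnS prednK // leq_subRL //; exact: ltnW.
  by rewrite ltnn.
apply: sorted_glue.
- by move=> i j _ ij; rewrite lerB // lez_nat part_le.
- by move=> i j _ ij; rewrite lerN2 lez_nat part_le.
move=> r0 s0; rewrite -subr_ge0 opprK addrAC subr_ge0 -PoszD lez_nat leqNgt.
apply/negP => lt; set p' := part (conjp lam) (m - s) in lt.
have p'n : p' <= n by exact: leq_trans (leq_addr _ _) (ltnW lt).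
have hl' : part lam p'.+1 < m - s by rewrite -conj_hook.
have hm' : part mu (n - p') < s.
  have n0 : 0 < n - p' by rewrite subn_gt0 (leq_ltn_trans (leq_addr _ _) lt).
  by rewrite -(prednK n0) -conj_hook // -ltnS prednK // ltn_subRL.
have sm' : s < m by rewrite -subn_gt0.
have [p'p _] : p' <= p /\ (p' = p -> s <= s).
  apply: mx => //; first exact: ltnW.
  by rewrite /in_hook (leq_trans _ (ltnW hm')) // part_le.
have hl2 : in_hook p (m - s.+1) lam.
  rewrite /in_hook subnS -ltnS prednK //.
  by apply: leq_ltn_trans hl'; rewrite part_le.
have hm2 : in_hook (n - p) s.+1 mu by exact: leqW.
by have [_ h] := mx p s.+1 pn sm' hl2 hm2; have := h erefl; rewrite ltnn.
Qed.

Definition pi_map (lm : Cr n m) : Xplus n m := exist _ (pi_tuples lm) (pi_dominant lm).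

End Pi.

Local Open Scope ring_scope.
Local Open Scope classical_set_scope.

Section Lines.
Variable R : realType.
Local Notation plane := (R * R)%type.

Definition segment (A B : plane) : set plane :=
  [set P | exists2 t : R, 0 <= t <= 1 &
    P = ((1 - t) * A.1 + t * B.1, (1 - t) * A.2 + t * B.2)].

Definition ray_right (A : plane) : set plane := [set P | A.1 <= P.1 /\ P.2 = A.2].
Definition ray_left (A : plane) : set plane := [set P | P.1 <= A.1 /\ P.2 = A.2].
Definition ray_up (A : plane) : set plane := [set P | P.1 = A.1 /\ A.2 <= P.2].
Definition ray_down (A : plane) : set plane := [set P | P.1 = A.1 /\ P.2 <= A.2].

(* [Ypt lam k] is the vertex M_(k+1): the indices k = 2i-2 and k = 2i-1
   (i >= 1) give (lam_i, i-1) and (lam_i, i). *)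
Definition Ypt (lam : intpart) (k : nat) : plane :=
  ((part lam k./2.+1)%:R, (uphalf k)%:R).

Definition Yline (lam : intpart) : set plane :=
  ray_right (Ypt lam 0) `|`
  \bigcup_(k in [set: nat]) segment (Ypt lam k) (Ypt lam k.+1).

Definition theta (n m : nat) (P : plane) : plane := (m%:R - P.1, n%:R - P.2).

Definition pt_lt (P Q : plane) : Prop :=
  P.2 < Q.2 \/ (P.2 = Q.2 /\ Q.1 < P.1).

(* For k < 2n, [Gpt a k] runs through (a_1,0), (a_1,1), (a_2,1), ...,
   (a_n,n-1), (a_n,n); note that a_i is the entry of [a] of index i-1. *)
Definition Gpt (n : nat) (a : n.-tuple int) (k : nat) : plane :=
  ((nth 0 a k./2)%:~R, (uphalf k)%:R).

Definition Gline (n : nat) (a : n.-tuple int) : set plane :=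
  ray_right (Gpt a 0) `|`
  \bigcup_(k in [set k | (k.+1 < n.*2)%N]) segment (Gpt a k) (Gpt a k.+1) `|`
  ray_left (Gpt a n.*2.-1).

(* For k < 2m, [Ghatpt n b k] runs through (0,n+b_1), (1,n+b_1), (1,n+b_2),
   ..., (m-1,n+b_m), (m,n+b_m). *)
Definition Ghatpt (n m : nat) (b : m.-tuple int) (k : nat) : plane :=
  ((uphalf k)%:R, n%:R + (nth 0 b k./2)%:~R).

Definition Ghatline (n m : nat) (b : m.-tuple int) : set plane :=
  ray_up (Ghatpt n b 0) `|`
  \bigcup_(k in [set k | (k.+1 < m.*2)%N])
    segment (Ghatpt n b k) (Ghatpt n b k.+1) `|`
  ray_down (Ghatpt n b m.*2.-1).

Definition is_max_point (S : set plane) (M : plane) : Prop :=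
  S M /\ forall P, S P -> P = M \/ pt_lt P M.

Definition left_of (M : plane) (Y : set plane) : set plane :=
  [set P | Y P /\ pt_lt P M].
Definition right_of (M : plane) (Y : set plane) : set plane :=
  [set P | Y P /\ pt_lt M P].

(* The defining property of sigma(lam, mu) = (a | b); the existence of the
   maximal intersection point M is part of it. *)
Definition is_sigma (n m : nat) (lm : Cr n m) (x : Xplus n m) : Prop :=
  let Yl := Yline (cr_lam lm) in
  let Ym := theta n m @` Yline (cr_mu lm) in
  exists M : plane,
    [/\ is_max_point (Yl `&` Ym) M,
        Gline (val x).1 = left_of M Yl `|` [set M] `|` right_of M Ym &
        Ghatline n (val x).2 = right_of M Yl `|` [set M] `|` left_of M Ym].

Lemma zero_dominant (n m : nat) :
  dominant ([tuple of nseq n 0], [tuple of nseq m 0]).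
Proof.
have h k : sorted (fun x y : int => y <= x) (nseq k 0).
  by case: k => //=; elim=> //= k ->; rewrite lexx.
by rewrite /dominant /= !h.
Qed.

Definition Xplus0 (n m : nat) : Xplus n m :=
  exist _ ([tuple of nseq n 0], [tuple of nseq m 0]) (zero_dominant n m).

(* The element of X^+ singled out by [is_sigma], [Xplus0] being the (dummy)
   value if there were none. *)
Definition sigma_map (n m : nat) (lm : Cr n m) : Xplus n m :=
  xget (Xplus0 n m) [set x | is_sigma lm x].

End Lines.

(* Main.v *)
(* All the lines are monotone staircases, and such a line is the set of the
   points (x, y) satisfying, for every row i, [f i <= x] if [y < i + 1] and
   [x <= f i] if [y > i].  In this form the conjugate partition gives the
   mirror image of the line in the diagonal, and gluing two staircases at a
   lattice corner lying on both of them is immediate.  The extremal pair (p, s)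
   is such that M = (m - s, p) is a corner of both lines and their maximal
   common point, so pi(lam, mu) is the gluing at M.  The description of the line
   of b is that of the line of a, for the conjugate partitions and with the two
   axes exchanged.  Uniqueness holds because a staircase determines its row
   ends. *)
Require Import Defs.
From mathcomp Require Import all_boot all_order all_algebra.
From mathcomp Require Import boolp classical_sets reals.
From mathcomp Require Import zify ring lra.
Set Implicit Arguments.
Unset Strict Implicit.
Unset Printing Implicit Defensive.
Import Order.TTheory GRing.Theory Num.Theory.
Local Open Scope ring_scope.
Local Open Scope classical_set_scope.

(** * Staircase lines and their description by inequalities *)

Section Staircases.
Variable R : realType.
Local Notation plane := (R * R)%type.
Implicit Types (P M : plane) (f : nat -> R) (lam mu : intpart).

Definition swap P : plane := (P.2, P.1).

(** [Ypt lam] and [Gpt a] are instances of this, and so is [Ghatpt n b] after [swap]; rows are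
    counted from 0. *)
Definition vertex f (k : nat) : plane := (f k./2, (uphalf k)%:R).

Definition gline N f : set plane :=
  ray_right (vertex f 0) `|`
  \bigcup_(k in [set k | (k.+1 < N.*2)%N])
    segment (vertex f k) (vertex f k.+1) `|`
  ray_left (vertex f N.*2.-1).

(** Strictly inside row i both implications apply and force x = f i. At an integer height the rows
    above bound x from below and the rows below bound it from above, which gives a horizontal step;
    at heights 0 and N one kind of bound disappears, which leaves a ray. *)
Definition stair (N : nat) f P : Prop :=
  [/\ 0 <= P.2, P.2 <= N%:R & forall i, (i < N)%N ->
    (P.2 < i.+1%:R -> f i <= P.1) /\ (i%:R < P.2 -> P.1 <= f i)].

Definition ystair lam P : Prop :=
  0 <= P.2 /\ forall i : nat,
    (P.2 < i.+1%:R -> (part lam i.+1)%:R <= P.1) /\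
    (i%:R < P.2 -> P.1 <= (part lam i.+1)%:R).

Lemma segment_swap (A B P : plane) :
  segment (swap A) (swap B) (swap P) <-> segment A B P.
Proof.
by case: P => x y; split=> -[t t01 [-> ->]]; exists t.
Qed.

Lemma segment_vertical (x y0 y1 : R) P : y0 < y1 ->
  segment (x, y0) (x, y1) P <-> P.1 = x /\ y0 <= P.2 <= y1.
Proof.
case: P => u v lt01; rewrite /segment /=; split=> [[t t01 [-> ->]]|[-> v01]].
  by split; [ring | apply/andP; split; nra].
have d0 : y1 - y0 != 0 by lra.
exists ((v - y0) / (y1 - y0)).
  by rewrite divr_ge0 ?ler_pdivrMr ?mul1r; lra.
by congr pair; field.
Qed.

Lemma segment_horizontal (x0 x1 y : R) P : x1 <= x0 ->
  segment (x0, y) (x1, y) P <-> P.2 = y /\ x1 <= P.1 <= x0.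
Proof.
case: P => u v; rewrite le_eqVlt => /predU1P[->|lt10]; rewrite /segment /=; split.
- by case=> t t01 [-> ->]; split; first ring; apply/andP; split; lra.
- case=> -> u01; exists 0; first by lra.
  by congr pair; lra.
- by case=> t t01 [-> ->]; split; [ring | apply/andP; split; nra].
case=> -> u01; have d0 : x0 - x1 != 0 by lra.
exists ((x0 - u) / (x0 - x1)).
  by rewrite divr_ge0 ?ler_pdivrMr ?mul1r; lra.
by congr pair; field.
Qed.

Lemma vertex_double f i : vertex f i.*2 = (f i, i%:R).
Proof. by rewrite /vertex doubleK uphalf_double. Qed.

Lemma vertex_doubleS f i : vertex f i.*2.+1 = (f i, i.+1%:R).
Proof. by rewrite /vertex /= uphalf_double doubleK. Qed.

Lemma segment_vertex_double f i P :
  segment (vertex f i.*2) (vertex f i.*2.+1) P <->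
  P.1 = f i /\ i%:R <= P.2 <= i.+1%:R.
Proof. by rewrite vertex_double vertex_doubleS segment_vertical ?ltr_nat. Qed.

Lemma segment_vertex_doubleS f i P : f i.+1 <= f i ->
  segment (vertex f i.*2.+1) (vertex f i.*2.+2) P <->
  P.2 = i.+1%:R /\ f i.+1 <= P.1 <= f i.
Proof.
move=> fi; rewrite vertex_doubleS -doubleS vertex_double.
exact: segment_horizontal.
Qed.

Section Antitone.
Variables (N : nat) (f : nat -> R).
Hypothesis N_gt0 : (0 < N)%N.
Hypothesis f_anti : forall i j, (i <= j)%N -> (j < N)%N -> f j <= f i.

Lemma ray_right_stair P : ray_right (vertex f 0) P -> stair N f P.
Proof.
case: P => x y [/= lex ->]; split=> /= [||i iN]; rewrite ?ler0n //.
split=> [_|]; first by apply: le_trans lex; apply: f_anti.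
by rewrite ltrn0.
Qed.

Lemma ray_left_stair P : ray_left (vertex f N.*2.-1) P -> stair N f P.
Proof.
rewrite -(prednK N_gt0) doubleS /= vertex_doubleS prednK //.
case: P => x y [/= lex ->]; split=> /= [||i iN]; rewrite ?ler0n //.
split=> [|_]; first by rewrite ltr_nat; lia.
by apply: (le_trans lex); apply: f_anti; lia.
Qed.

Lemma segment_stair k P : (k.+1 < N.*2)%N ->
  segment (vertex f k) (vertex f k.+1) P -> stair N f P.
Proof.
(* Segments of odd index are horizontal, those of even index vertical; the odd case comes first. *)
rewrite -(odd_double_half k); set i := k./2; case: (odd k) => /= iN.
  have iN' : (i.+1 < N)%N by lia.
  move=> /segment_vertex_doubleS[]; first exact: f_anti.
  case: P => x y /= -> /andP[lex xle].
  split=> /= [||j jN]; rewrite ?ler0n ?ler_nat //; first exact: ltnW.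
  rewrite !ltr_nat; split=> ij.
    by apply: le_trans lex; apply: f_anti.
  by apply: (le_trans xle); apply: f_anti => //; lia.
have iN' : (i < N)%N by lia.
move=> /segment_vertex_double; case: P => x y /= [-> /andP[ley yle]].
split=> /= [||j jN]; first exact: le_trans ley.
  by apply: le_trans yle _; rewrite ler_nat.
split=> [/(le_lt_trans ley)|/lt_le_trans/(_ yle)]; rewrite ltr_nat => ij;
  by apply: f_anti => //; lia.
Qed.

(** The height in the last case is recorded so that [YlineP] can exclude the left ray, which the
    infinite line does not have. *)
Lemma stair_pieces P : stair N f P ->
  [\/ ray_right (vertex f 0) P,
      exists2 k, (k.+1 < N.*2)%N & segment (vertex f k) (vertex f k.+1) P |
      P.2 = N%:R /\ ray_left (vertex f N.*2.-1) P].
Proof.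
case: P => x y [/= y0 yN h].
have /andP[] := truncn_itv y0; set i := Num.truncn y => iy yi.
have [iy'|yi'] := ltP i%:R y.
  have iN : (i < N)%N by rewrite -(ltr_nat R); apply: lt_le_trans yN.
  have [/(_ yi) h1 /(_ iy') h2] := h i iN.
  apply: Or32; exists i.*2; first by lia.
  by apply/segment_vertex_double => /=; split; [apply/le_anti/andP | rewrite iy ltW].
(* What remains is an integer height: N gives the left ray, 0 the right ray, any other a horizontal
   segment. *)
have {iy yi yi' y0} {i}[i yE] : exists i, y = i%:R.
  by exists i; apply/le_anti/andP.
move: yN h; rewrite {}yE ler_nat.
rewrite leq_eqVlt => /predU1P[->|iN] h.
  apply: Or33; rewrite -(prednK N_gt0) doubleS /= vertex_doubleS prednK //.
  have [_] := h N.-1 ltac:(lia); rewrite ltr_nat => hx.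
  by split=> //; split=> //=; apply: hx; lia.
case: i iN h => [|i] iN h.
  by apply: Or31; split=> //=; apply: (h 0%N N_gt0).1; rewrite ltr_nat.
apply: Or32; exists i.*2.+1; first by lia.
apply/segment_vertex_doubleS; first exact: f_anti.
split=> //=; apply/andP; split.
  by apply: (h _ iN).1; rewrite ltr_nat.
by apply: (h i (ltnW iN)).2; rewrite ltr_nat.
Qed.

Lemma glineP P : gline N f P <-> stair N f P.
Proof.
split=> [[[|[k /= kN]]|]|/stair_pieces[|[k kN]|[_]]].
- exact: ray_right_stair.
- exact: segment_stair.
- exact: ray_left_stair.
- by left; left.
- by left; right; exists k.
- by right.
Qed.

End Antitone.

Lemma YlineP lam P : Yline lam P <-> ystair lam P.
Proof.
pose f i : R := (part lam i.+1)%:R.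
have f_anti N i j : (i <= j)%N -> (j < N)%N -> f j <= f i.
  by move=> ij _; rewrite ler_nat part_le.
split=> [YP|[y0 h]].
  (* The inequality for row i is read off a finite staircase with more than i rows. *)
  have st N : exists2 N', (N < N')%N & stair N' f P.
    case: YP => [rP|[k _ sP]].
      by exists N.+1 => //; apply: ray_right_stair => // i j; apply: f_anti.
    exists (N + k).+2; first by lia.
    by apply: segment_stair sP => [|i j|]; [lia | exact: f_anti | lia].
  split=> [|i]; first by have [N' _ []] := st 0%N.
  by have [N' iN' [_ _ /(_ i iN')]] := st i.
(* Cutting at an integer strictly above the point keeps it off the left ray. *)
have /andP[_ yN] := truncn_itv y0.
have : stair (Num.truncn P.2).+1 f P by split=> [||i _]; [|exact: ltW|exact: h].
case/stair_pieces=> // [|rP|[k _ sP]|[yE]].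
- by move=> i j; apply: f_anti.
- by left.
- by right; exists k.
- by move: yN; rewrite {1}yE ltxx.
Qed.

(** By [conj_hook], column j has length at most i exactly when row i + 1 is shorter than j. A bound
    violated at one row thus contradicts the bound at the column next to the end of that row, and
    conversely. *)
Lemma ystair_conj lam P : ystair (conjp lam) (swap P) <-> ystair lam P.
Proof.
case: P => x y; rewrite /ystair /swap /=; split=> -[x0 h].
  split=> [|i].
    have /andP[_ /(h _).1] := truncn_itv x0.
    exact: le_trans.
  split=> hy.
    have [//|ltx] := leP (part lam i.+1)%:R x.
    have l0 : (0 < part lam i.+1)%N by rewrite -(ltr_nat R) (le_lt_trans x0).
    have [/(_ _)/[!prednK]// + _] := h (part lam i.+1).-1; move/(_ ltx) => hx.
    have : (part (conjp lam) (part lam i.+1) <= i)%N.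
      by rewrite -ltnS -(ltr_nat R) (le_lt_trans hx).
    by rewrite conj_hook // ltnn.
  have [//|ltx] := leP x (part lam i.+1)%:R.
  have [_ /(_ ltx) hx] := h (part lam i.+1).
  have : ~~ (part (conjp lam) (part lam i.+1).+1 <= i)%N.
    by rewrite -ltnNge -(ltr_nat R) (lt_le_trans hy).
  by rewrite conj_hook // ltnS leqnn.
split=> [|i].
  have /andP[_ /(h _).1] := truncn_itv x0.
  exact: le_trans.
set c := part (conjp lam) i.+1; split=> hx.
  have [//|lty] := leP c%:R y.
  have c0 : (0 < c)%N by rewrite -(ltr_nat R) (le_lt_trans x0).
  have : ~~ (c <= c.-1)%N by lia.
  rewrite conj_hook // prednK // ltnS -ltnNge.
  have [+ _] := h c.-1; rewrite prednK // => /(_ lty) hx'.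
  by rewrite -(ler_nat R) => /(lt_le_trans hx)/lt_le_trans/(_ hx'); rewrite ltxx.
have [//|lty] := leP y c%:R.
have : (c <= c)%N by []; rewrite {1}/c conj_hook // ltnS -(ler_nat R).
have [_ /(_ lty) hx'] := h c.
by move=> /(le_trans hx')/(lt_le_trans hx); rewrite ltxx.
Qed.

(** * Gluing two staircases at a common corner *)

Section Glue.
Variables (n m p q r s : nat) (lam mu : intpart).
Hypotheses (pq : (p + q)%N = n) (rs : (r + s)%N = m).
Hypotheses (lam_p1 : (part lam p.+1 <= r)%N) (mu_q1 : (part mu q.+1 <= s)%N).
Hypotheses (lam_p : (0 < p)%N -> (r <= part lam p)%N).
Hypotheses (mu_q : (0 < q)%N -> (s <= part mu q)%N).

Let M : plane := (r%:R, p%:R).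

(** The section hypotheses make M a corner of both lines, so the ends of the rows below p are at
    least r and those above at most r. Right of r and below p, the rows from p on impose nothing
    new, and only [lam] matters; on the other side only [mu] does. The row ends [f] are arbitrary
    reals so that this serves both for a and for b. *)
Lemma stair_glue f P :
  (forall i, (i < p)%N -> f i = (part lam i.+1)%:R) ->
  (forall i, (p <= i < n)%N -> f i = m%:R - (part mu (n - i))%:R) ->
  stair n f P <->
  (ystair lam P /\ pt_lt P M) \/ P = M \/
  (ystair mu (theta n m P) /\ pt_lt M P).
Proof.
move=> f_lam f_mu.
have nE : n%:R = p%:R + q%:R :> R by rewrite -pq natrD.
have mE : m%:R = r%:R + s%:R :> R by rewrite -rs natrD.
have f_ge i : (i < p)%N -> r%:R <= f i.
  move=> ip; rewrite f_lam // ler_nat.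
  by apply: leq_trans (lam_p _) _; [lia | exact: part_le].
have f_le i : (p <= i < n)%N -> f i <= r%:R.
  move=> pi; rewrite f_mu // mE lerBlDr lerD2l ler_nat.
  by apply: leq_trans (mu_q _) _; [lia | apply: part_le; lia].
have lam_le i : (p <= i)%N -> (part lam i.+1)%:R <= r%:R :> R.
  by move=> pi; rewrite ler_nat (leq_trans _ lam_p1) // part_le.
have mu_le i : (q <= i)%N -> (part mu i.+1)%:R <= s%:R :> R.
  by move=> qi; rewrite ler_nat (leq_trans _ mu_q1) // part_le.
(* [theta] turns row i of [mu] upside down into row n - i - 1, exchanging lower and upper bounds. *)
have f_mu' i : (i < q)%N ->
    f (n - i.+1)%N = m%:R - (part mu i.+1)%:R /\
    (n - i.+1)%N%:R = n%:R - i.+1%:R :> R.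
  move=> iq; split; last by rewrite natrB //; lia.
  by rewrite f_mu ?subKn //; lia.
case: P => x y; split.
- case=> /= y0 yn h.
  have below : y <= p%:R -> r%:R <= x -> ystair lam (x, y).
    move=> yp rx; split=> //= i; have [ip|pi] := ltnP i p.
      by rewrite -f_lam //; apply: h; lia.
    have pi' : p%:R <= i%:R :> R by rewrite ler_nat.
    by split=> [_|]; [exact: le_trans (lam_le i pi) rx | lra].
  have above : p%:R <= y -> x <= r%:R -> ystair mu (theta n m (x, y)).
    move=> py xr; split=> /= [|i]; first by rewrite subr_ge0.
    have [iq|qi] := ltnP i q.
      have [fE jE] := f_mu' i iq.
      have := h (n - i.+1)%N ltac:(lia).
      by rewrite fE -(natr1 (n - i.+1)) jE -(natr1 i) => -[h1 h2]; split=> hi;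
        [have := h2 ltac:(lra) | have := h1 ltac:(lra)]; lra.
    have qi' : q%:R <= i%:R :> R by rewrite ler_nat.
    by split=> [_|]; [have := mu_le i qi; lra | lra].
  (* The order on points compares heights first; at height p the abscissa decides. *)
  have [lty|lty|yE] := ltgtP y p%:R.
  + left; split; last by left.
    have p0 : (0 < p)%N by rewrite -(ltr_nat R) (le_lt_trans y0).
    apply: below; first exact: ltW.
    apply: le_trans (f_ge p.-1 _) _; first by rewrite prednK.
    by apply: (h p.-1 ltac:(lia)).1; rewrite prednK.
  + right; right; split; last by left.
    have pn : (p < n)%N by rewrite -(ltr_nat R) (lt_le_trans lty).
    apply: above; first exact: ltW.
    apply: le_trans (f_le p _); last by rewrite leqnn.
    exact: (h p pn).2.
  have [ltx|ltx|xE] := ltgtP x r%:R.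
  + by right; right; split; [apply: above; rewrite ?yE // ltW | right].
  + by left; split; [apply: below; rewrite ?yE // ltW | right].
  + by right; left; rewrite xE yE.
move=> PM.
have {PM}[[lamP lty]|[[-> ->]|[muP lty]]] := PM.
- have yp : y <= p%:R by case: lty => /= [/ltW|[->]].
  case: lamP => /= y0 h.
  have rx : r%:R <= x.
    case: lty => /= [lty|[_ /ltW//]].
    have p0 : (0 < p)%N by rewrite -(ltr_nat R) (le_lt_trans y0).
    apply: le_trans (f_ge p.-1 _) _; first by rewrite prednK.
    have := (h p.-1).1; rewrite f_lam prednK //; exact.
  split=> //= [|i iN]; first by have := ler0n R q; lra.
  have [ip|pi] := ltnP i p; first by rewrite f_lam.
  have pi' : p%:R <= i%:R :> R by rewrite ler_nat.
  by split=> [_|]; [apply: le_trans (f_le i _) rx; lia | lra].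
- split=> /= [||i iN]; rewrite ?ler_nat ?ltr_nat //; first by lia.
  split=> hi; first by apply: f_le; lia.
  by apply: f_ge; lia.
have py : p%:R <= y by case: lty => /= [/ltW|[->]].
case: muP => /= ny h.
have xr : x <= r%:R.
  case: lty => /= [lty|[_ /ltW//]].
  have q0 : (0 < q)%N by rewrite -(ltr_nat R); lra.
  have := mu_q q0; rewrite -(ler_nat R).
  by have := (h q.-1).1; rewrite prednK // => /(_ ltac:(lra)); lra.
split=> /= [||i iN]; [exact: le_trans py | by lra |].
have [ip|pi] := ltnP i p.
  split=> [|_]; last exact: le_trans xr (f_ge i ip).
  have : i.+1%:R <= p%:R :> R by rewrite ler_nat.
  by lra.
have := h (n - i.+1)%N; rewrite f_mu ?pi // (subnSK iN).
rewrite !natrB // 1?ltnW // -(natr1 i) => -[h1 h2].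
by split=> hi; [have := h2 ltac:(lra) | have := h1 ltac:(lra)]; lra.
Qed.

End Glue.

(** * Recovering row ends; the two reflections and the order of points *)

Lemma gline_inj N f g :
  (forall i j, (i <= j)%N -> (j < N)%N -> f j <= f i) ->
  (forall i j, (i <= j)%N -> (j < N)%N -> g j <= g i) ->
  gline N f = gline N g -> forall i, (i < N)%N -> f i = g i.
Proof.
move=> f_anti g_anti fg i iN; have N_gt0 : (0 < N)%N by lia.
(* At the midpoint of the vertical edge of row i both bounds for [g i] are active. *)
have : gline N f (f i, i%:R + 2^-1).
  left; right; exists i.*2 => /=; first by lia.
  by apply/segment_vertex_double; split=> //=; rewrite -(natr1 i); apply/andP; split; lra.
rewrite fg => /(glineP N_gt0 g_anti)[_ _ /(_ i iN)] /=; rewrite -(natr1 i) => -[h1 h2].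
by apply/le_anti/andP; split; [apply: h2 | apply: h1]; lra.
Qed.

Lemma theta_theta n m P : theta n m (theta n m P) = P.
Proof. by case: P => x y; rewrite /theta /= !subKr. Qed.

Lemma theta_imageP n m mu P :
  (theta n m @` Yline mu) P <-> ystair mu (theta n m P).
Proof.
split=> [[Q /YlineP YQ <-]|/YlineP YP]; first by rewrite theta_theta.
by exists (theta n m P) => //; rewrite theta_theta.
Qed.

Lemma pt_lt_theta n m P M : pt_lt (theta n m P) (theta n m M) <-> pt_lt M P.
Proof.
case: P M => [x y] [u v]; rewrite /pt_lt /=.
by split=> -[h|[h1 h2]]; (left; lra) || (right; lra).
Qed.

Lemma pt_lt_asym P M : pt_lt P M -> pt_lt M P -> False.
Proof. by rewrite /pt_lt => -[h|[h1 h2]] [h'|[h3 h4]]; lra. Qed.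

(** The row whose index is the integer part of [P.2] ends between the two abscissas. *)
Lemma ystair_anti lam P M : ystair lam P -> ystair lam M ->
  P.2 < M.2 -> M.1 <= P.1.
Proof.
move=> [y0 hP] [_ hM] lt.
have /andP[ly yl] := truncn_itv y0.
apply: le_trans ((hP (Num.truncn P.2)).1 yl).
by apply: (hM _).2; apply: le_lt_trans lt.
Qed.

(* Reflecting in the diagonal maps staircases to staircases but reverses the
   order along each of them. *)
Lemma pt_lt_swap lam P M : ystair lam P -> ystair lam M ->
  pt_lt (swap P) (swap M) <-> pt_lt M P.
Proof.
move=> YP YM; have a1 := ystair_anti YM YP.
have /ystair_conj YP' := YP; have /ystair_conj YM' := YM.
have := ystair_anti YP' YM'; move: a1; rewrite /swap /pt_lt /=.
case: P M {YP YM YP' YM'} => [x y] [u v] /= a1 a2; split=> -[lt|[e lt]].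
- have := a2 lt; rewrite le_eqVlt => /predU1P[|]; by [right|left].
- by left.
- have := a1 lt; rewrite le_eqVlt => /predU1P[|]; by [right|left].
- by left.
Qed.

Lemma ystair_corner lam p r : (part lam p.+1 <= r)%N ->
  ((0 < p)%N -> (r <= part lam p)%N) -> ystair lam (r%:R, p%:R).
Proof.
move=> h1 h2; split=> //= i; rewrite !ltr_nat !ler_nat; split=> ip.
  by apply: leq_trans h1; apply: part_le; lia.
by apply: leq_trans (h2 _) _; [lia | apply: part_le].
Qed.

End Staircases.

(** Positions count from 0 but parts from 1; the result has the shape of the hypotheses on [f] in
    [stair_glue]. *)
Lemma nth_cat_rev (f g : nat -> int) (p q i : nat) : (i < p + q)%N ->
  nth 0 ([seq f i | i <- iota 1 p] ++ [seq g i | i <- rev (iota 1 q)]) i =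
  if (i < p)%N then f i.+1 else g (p + q - i)%N.
Proof.
move=> ipq; rewrite nth_cat size_map size_iota; case: ltnP => ip.
  by rewrite (nth_map 0%N) ?size_iota // nth_iota.
rewrite (nth_map 0%N) ?size_rev ?size_iota; last by lia.
rewrite nth_rev ?size_iota; last by lia.
by rewrite nth_iota; [congr g; lia | lia].
Qed.

Lemma sorted_nth_anti (s : seq int) i j :
  sorted (fun x y : int => y <= x) s -> (i <= j)%N -> (j < size s)%N ->
  nth 0 s j <= nth 0 s i.
Proof.
move=> ss ij js.
have tr : transitive (fun x y : int => y <= x).
  by move=> x y z h1 h2; apply: le_trans h2 h1.
by apply: (sorted_leq_nth tr _ 0 ss) => //; rewrite inE; lia.
Qed.

(** * The extremal pair as a corner of both lines *)

Section Extremal.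
Variables (n m : nat) (lm : Cr n m).
Let lam := cr_lam lm.
Let mu := cr_mu lm.
Let p := ext_p n m lam mu.
Let s := ext_s n m lam mu.

(** A strict inequality in the first clause would put (p, s + 1) in H, against the choice of s;
    failure of the last would put (p + 1, s) in H, against the choice of p. *)
Lemma ext_corner :
  [/\ part lam p.+1 = (m - s)%N, (0 < p -> m - s <= part lam p)%N,
      (part mu (n - p).+1 <= s)%N & (0 < n - p -> s <= part mu (n - p))%N].
Proof.
have [pn sm hl hm mx] := extP lm; rewrite -/lam -/mu -/p -/s in pn sm hl hm mx.
rewrite /in_hook in hl hm.
have lamE : part lam p.+1 = (m - s)%N.
  apply/eqP; rewrite eqn_leq hl leqNgt; apply/negP => lt.
  have [] := mx p s.+1 pn; [by lia | rewrite /in_hook; lia | exact: leqW |].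
  by move=> _ /(_ erefl); rewrite ltnn.
split=> // [_|q0]; first by rewrite -lamE part_le.
rewrite leqNgt; apply/negP => lt.
have [] := mx p.+1 s _ sm; [by lia | | | by rewrite ltnn].
  by rewrite /in_hook -lamE part_le.
by rewrite /in_hook (_ : (n - p.+1).+1 = n - p)%N; [exact: ltnW | lia].
Qed.

End Extremal.

Lemma GlineP (R : realType) n m (x : Xplus n m) : (0 < n)%N ->
  forall P : R * R, Gline (val x).1 P <->
    stair n (fun i => (nth 0 (val x).1 i)%:~R) P.
Proof.
move=> n_gt0 P; apply: glineP => // i j ij jn.
rewrite ler_int sorted_nth_anti ?size_tuple //.
by have /andP[] := valP x.
Qed.

Lemma Ghatline_swap (R : realType) n m (b : m.-tuple int) (P : R * R) :
  Ghatline n b P <-> gline m (fun i => n%:R + (nth 0 b i)%:~R) (swap P).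
Proof.
split=> [[[[]|[k km]]|[]]|[[[]|[k km]]|[]]].
- by left; left.
- by move=> /segment_swap sP; left; right; exists k.
- by right.
- by left; left.
- by move=> sP; left; right; exists k => //; apply/segment_swap.
- by right.
Qed.

Lemma GhatlineP (R : realType) n m (x : Xplus n m) : (0 < m)%N ->
  forall P : R * R, Ghatline n (val x).2 P <->
    stair m (fun i => n%:R + (nth 0 (val x).2 i)%:~R) (swap P).
Proof.
move=> m_gt0 P; apply: (iff_trans (Ghatline_swap _ _ _)).
apply: glineP => // i j ij jn.
rewrite lerD2l ler_int sorted_nth_anti ?size_tuple //.
by have /andP[] := valP x.
Qed.

(** * The map pi has the defining property of sigma *)

Section PiSigma.
Variables (R : realType) (n m : nat) (lm : Cr n m).
Hypotheses (n_gt0 : (0 < n)%N) (m_gt0 : (0 < m)%N).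
Let lam := cr_lam lm.
Let mu := cr_mu lm.
Let p := ext_p n m lam mu.
Let s := ext_s n m lam mu.
Let M : R * R := ((m - s)%N%:R, p%:R).

Lemma ext_max_point :
  is_max_point (Yline lam `&` (theta n m @` Yline mu)) M.
Proof.
have [pn sm _ _ mx] := extP lm; rewrite -/lam -/mu -/p -/s in pn sm mx.
have [lamE lam_p mu_q1 mu_q] := ext_corner lm.
rewrite -/lam -/mu -/p -/s in lamE lam_p mu_q1 mu_q.
have MY : (Yline lam `&` (theta n m @` Yline mu)) M.
  split; first by apply/YlineP; apply: ystair_corner => //; rewrite lamE.
  apply/theta_imageP; rewrite /theta /= -!natrB ?leq_subr // subKn //.
  exact: ystair_corner.
split=> // -[x y] [/YlineP[/= y0 hlam] /theta_imageP[/= ny hmu]].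
have [lty|lty|yE] := ltgtP y p%:R; first by right; left.
- exfalso.
  (* With k the ceiling of y, the point (lam_(k+1), k) still lies weakly outside
     both diagrams, so (k, m - lam_(k+1)) is in H(lam, mu) although k > p. *)
  have ex : exists k : nat, y <= k%:R.
    by have /andP[_ /ltW] := truncn_itv y0; exists (Num.truncn y).+1.
  have {ex} [k yk kmin] := ex_minnP ex.
  have pk : (p < k)%N by rewrite -(ltr_nat R) (lt_le_trans lty).
  have ky : k.-1%:R < y.
    by rewrite ltNge; apply/negP => /kmin; lia.
  have kn : (k <= n)%N by apply: kmin; lra.
  have kE : k.-1%:R = k%:R - 1 :> R by rewrite -[in RHS](@prednK k) -?natr1; [lra | lia].
  have nkE : (n - k).+1%:R = n%:R - k%:R + 1 :> R by rewrite -natr1 natrB.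
  (* Since y < k + 1 and n - y < n - k + 1, the lower bounds of row k of [lam] and row n - k of [mu]
     are active; adding them eliminates x. *)
  have lamx : (part lam k.+1)%:R <= x.
    by apply: (hlam k).1; rewrite -natr1; lra.
  have mux : (part mu (n - k).+1)%:R <= m%:R - x.
    by apply: (hmu (n - k)%N).1; lra.
  have le_m : (part lam k.+1 + part mu (n - k).+1 <= m)%N.
    by rewrite -(ler_nat R) natrD; lra.
  have [] := mx k (m - part lam k.+1)%N kn (leq_subr _ _).
  + by rewrite /in_hook; lia.
  + by rewrite /in_hook; lia.
  by rewrite leqNgt pk.
(* At height p a greater point would lie further left, but row p of [lam] ends exactly at m - s. *)
have rx : (m - s)%N%:R <= x.
  by rewrite -lamE; apply: (hlam p).1; rewrite yE ltr_nat.
move: rx; rewrite le_eqVlt => /predU1P[xE|rx]; first by left; rewrite /M xE yE.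
by right; right.
Qed.

Lemma pi_is_sigma : is_sigma R lm (pi_map lm).
Proof.
have [[/YlineP Ylam /theta_imageP Ymu] _] := ext_max_point.
have [pn sm _ _ _] := extP lm; rewrite -/lam -/mu -/p -/s in pn sm.
have [lamE lam_p mu_q1 mu_q] := ext_corner lm.
rewrite -/lam -/mu -/p -/s in lamE lam_p mu_q1 mu_q.
have lam_p1 : (part lam p.+1 <= m - s)%N by rewrite lamE.
exists M; split; first exact: ext_max_point.
  apply/predeqP => P.
  apply: (iff_trans (GlineP (pi_map lm) n_gt0 P)).
  apply: (iff_trans (stair_glue (subnKC pn) (subnK sm) lam_p1 mu_q1 lam_p mu_q _ _ _)).
  - move=> i ip; rewrite /= nth_cat_rev; last by lia.
    by rewrite ip.
  - move=> i /andP[pi iN]; rewrite /= nth_cat_rev; last by lia.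
    by rewrite ltnNge pi /= subnKC // intrB.
  rewrite -(YlineP lam P) -(theta_imageP n m mu P).
  by rewrite /left_of /right_of /setU /mkset; tauto.
apply/predeqP => P.
apply: (iff_trans (GhatlineP (pi_map lm) m_gt0 P)).
(* For b the roles of n, p and m, m - s are exchanged; [conj_hook] carries the corner conditions
   over to the conjugates, and the shift by n in [Ghatline] cancels the one in [pi_b]. *)
apply: (iff_trans (stair_glue (subnK sm) (subnKC pn)
  (lam := conjp lam) (mu := conjp mu) _ _ _ _ _ _ _)).
- by rewrite conj_hook.
- by rewrite conj_hook.
- by case: (p) lam_p => // p' h r0; rewrite ltnNge conj_hook // -leqNgt h.
- by case: (n - p)%N mu_q => // q' h s0; rewrite ltnNge conj_hook // -leqNgt h.
- move=> i ir; rewrite /= nth_cat_rev; last by lia.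
  by rewrite ir intrB addrC subrK.
- move=> i /andP[ri im]; rewrite /= nth_cat_rev; last by lia.
  by rewrite ltnNge ri /= subnK // intrN.
have swapE Q : theta m n (swap Q) = swap (theta n m Q) by [].
(* Undoing the reflection reverses the order along each line, so b receives the right part of the
   line of [lam] and the left part of that of [mu]. *)
rewrite -[(_, _)]/(swap M) swapE !ystair_conj.
have lam_lt : ystair lam P -> pt_lt (swap P) (swap M) <-> pt_lt M P.
  by move=> YP; apply: pt_lt_swap YP Ylam.
have mu_lt : ystair mu (theta n m P) ->
    pt_lt (swap M) (swap P) <-> pt_lt P M.
  move=> YP; rewrite -(pt_lt_theta m n) !swapE (pt_lt_swap YP Ymu).
  exact: pt_lt_theta.
have swap_eq : swap P = swap M <-> P = M.
  by case: P {lam_lt mu_lt} => x y; split=> [[-> ->]|[-> ->]].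
move: lam_lt mu_lt; rewrite -(YlineP lam P) -(theta_imageP n m mu P).
by rewrite /left_of /right_of /setU /mkset; tauto.
Qed.

End PiSigma.

(** A maximal point is unique by asymmetry of the order, so both candidates have the same two lines,
    and these determine the entries. *)
Lemma is_sigma_inj (R : realType) n m (lm : Cr n m) (x y : Xplus n m) :
  (0 < n)%N -> (0 < m)%N -> is_sigma R lm x -> is_sigma R lm y -> x = y.
Proof.
move=> n_gt0 m_gt0 [M [[MY Mmax] Gx Hx]] [M' [[MY' Mmax'] Gy Hy]].
have MM' : M = M'.
  have [//|lt] := Mmax' _ MY; have [//|lt'] := Mmax _ MY'.
  by case: (pt_lt_asym lt lt').
rewrite -{}MM' in Gy Hy.
have nth_inj (N : nat) (a b : N.-tuple int) :
    (forall i, (i < N)%N -> nth 0 a i = nth 0 b i) -> a = b.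
  move=> ab; apply/val_inj/(@eq_from_nth _ 0) => [|i]; rewrite !size_tuple //.
  exact: ab.
have anti (N : nat) (a : N.-tuple int) i j :
    sorted (fun x y : int => y <= x) a -> (i <= j)%N -> (j < N)%N ->
    (nth 0 a j)%:~R <= (nth 0 a i)%:~R :> R.
  by move=> sa ij jN; rewrite ler_int sorted_nth_anti ?size_tuple.
have /andP[x1 x2] := valP x; have /andP[y1 y2] := valP y.
apply: val_inj; rewrite [val x]surjective_pairing [val y]surjective_pairing.
congr pair; apply: nth_inj => i iN; apply: (intr_inj (R := R)).
  have eqG : Gline (val x).1 = Gline (val y).1 :> set (R * R) by rewrite Gx Gy.
  move: i iN; apply: gline_inj eqG => i j; exact: anti.
have eqG : gline m (fun i => n%:R + (nth 0 (val x).2 i)%:~R) =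
           gline m (fun i => n%:R + (nth 0 (val y).2 i)%:~R) :> set (R * R).
  apply/predeqP => -[u v]; rewrite -[(u, v)]/(swap (v, u)) -!Ghatline_swap.
  by rewrite Hx Hy.
apply: (addrI n%:R); move: i iN; apply: gline_inj eqG => i j ij jm;
  by rewrite lerD2l; apply: anti.
Qed.

Theorem proposition5p12 (R : realType) (n m : nat)
    (hn : (0 < n)%N) (hm : (0 < m)%N) (lm : Cr n m) :
  (exists! x : Xplus n m, is_sigma R lm x) /\ pi_map lm = sigma_map R lm.
Proof.
have pi_sigma := pi_is_sigma R lm hn hm.
split; first by exists (pi_map lm); split=> // x; apply: is_sigma_inj.
(* [pi_map lm] witnesses that the set is inhabited, so [xget] picks an element of it and not the
   default [Xplus0]. *)
apply: is_sigma_inj (xgetPex _ _) => //; by exists (pi_map lm).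
Qed.
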